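(* Let $S$ be a countable set and let $\mathcal{H}$ be a Hilbert space over $\mathbb{C}$ (or $\mathbb{R}$). Assume that there is a tight frame $(\mathbf{v}(s))_{s\in S}$ for $\mathcal{H}$ with frame constant $c>0$. Identify each $f\in\mathcal{H}$ with the function on $S$ given by $f(s)=\langle\mathbf{v}(s)\mid f\rangle$, $s\in S$. Then $\mathcal{H}$ is a reproducing kernel Hilbert space (i.e. this identification is injective and realizes $\mathcal{H}$ as a closed subspace of $\ell^2(S)$ on which, for every $s\in S$, the evaluation $f\mapsto f(s)$ is continuous), and $$|f(s)|\leq k(s,s)^{1/2}\,\|f\|_{\mathcal{H}}\qquad\text{for all }s\in S\text{ and }f\in\mathcal{H},$$ where $k(s,t)=\langle\mathbf{v}(s)\mid\mathbf{v}(t)\rangle$ is the Gram matrix.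
   Context: Inner products $\langle\cdot\mid\cdot\rangle$ are conjugate-linear in the first variable. A family $(\mathbf{v}(s))_{s\in S}$ in $\mathcal{H}$ is a tight frame with frame constant $c>0$ if $\|f\|^2=c\sum_{s\in S}|\langle\mathbf{v}(s)\mid f\rangle|^2$ for all $f\in\mathcal{H}$. A closed subspace of $\ell^2(S)$ is called a reproducing kernel subspace if for every $s\in S$ the mapping $f\mapsto f(s)$ is continuous on it. *)

(* Defs.v *)
From HB Require Import structures.
From mathcomp Require Import all_boot all_order all_algebra.
From mathcomp Require Import ring lra.
From mathcomp Require Import sesquilinear complex.
From mathcomp Require Import all_classical all_reals.
From mathcomp Require Import ereal esum topology normedtype.
Set Implicit Arguments.
Unset Strict Implicit.
Unset Printing Implicit Defensive.
Import Order.TTheory GRing.Theory Num.Theory.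
Import numFieldNormedType.Exports.
Local Open Scope classical_set_scope.
Local Open Scope ring_scope.

Variant scalar_kind := RealScalars | ComplexScalars.

Definition scalars (R : realType) (F : scalar_kind) : numFieldType :=
  match F with RealScalars => R | ComplexScalars => R[i] end.

Section Scalars.
Variables (R : realType) (F : scalar_kind).

Definition scalar_conj : scalars R F -> scalars R F :=
  match F return scalars R F -> scalars R F with
  | RealScalars => id
  | ComplexScalars => @conjc R
  end.

Definition real_part : scalars R F -> R :=
  match F return scalars R F -> R with
  | RealScalars => id
  | ComplexScalars => @complex.Re R
  end.

Definition of_real : R -> scalars R F :=
  match F return R -> scalars R F with
  | RealScalars => id
  | ComplexScalars => real_complex R
  end.

(* Norms over [scalars R F] take their values in [scalars R F], where they are
   nonnegative reals; [rnorm x] is the element of [R] equal to [`|x|], see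
   [of_rnorm]. *)
Definition rnorm (V : normedZmodType (scalars R F)) (x : V) : R :=
  real_part `|x|.

End Scalars.

Section ScalarsTheory.
Variables (R : realType) (F : scalar_kind).
Local Notation K := (scalars R F).

Lemma of_realK : cancel (@of_real R F) (@real_part R F).
Proof. by case: F. Qed.

Lemma of_real_le (a b : R) : (of_real F a <= of_real F b) = (a <= b).
Proof. by case: F => //; exact: lecR. Qed.

Lemma of_realD (a b : R) : of_real F (a + b) = of_real F a + of_real F b.
Proof. by case: F => //; exact: rmorphD. Qed.

Lemma of_realM (a b : R) : of_real F (a * b) = of_real F a * of_real F b.
Proof. by case: F => //; exact: rmorphM. Qed.

Lemma of_real0 : of_real F (0 : R) = 0.
Proof. by case: F. Qed.

Lemma real_partK (x : K) : 0 <= x -> of_real F (real_part x) = x.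
Proof.
move: x; case: F => //= -[a b].
by rewrite lecE /= => /andP[/eqP -> _].
Qed.

Section Norm.
Variable V : normedZmodType K.
Implicit Types x y : V.

Lemma of_rnorm x : of_real F (rnorm x) = `|x|.
Proof. exact: real_partK. Qed.

Lemma rnorm_ge0 x : 0 <= rnorm x.
Proof. by rewrite -(of_real_le) of_rnorm of_real0. Qed.

Lemma rnormD x y : rnorm (x + y) <= rnorm x + rnorm y.
Proof. by rewrite -(of_real_le) of_realD !of_rnorm ler_normD. Qed.

Lemma rnorm0 : rnorm (0 : V) = 0.
Proof. by apply: (can_inj of_realK); rewrite of_rnorm normr0 of_real0. Qed.

Lemma rnorm0_eq0 x : rnorm x = 0 -> x = 0.
Proof. by move=> x0; apply/eqP; rewrite -normr_eq0 -of_rnorm x0 of_real0. Qed.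

End Norm.

Lemma rnormM (x y : K) : rnorm (x * y) = rnorm x * rnorm y.
Proof. by apply: (can_inj of_realK); rewrite of_realM !of_rnorm normrM. Qed.

End ScalarsTheory.

Section SquareSums.
Variables (R : realType) (F : scalar_kind) (S : countType).
Local Notation K := (scalars R F).
Implicit Types f g : S -> K.

Definition sqsum f : \bar R := \esum_(s in [set: S]) (rnorm (f s) ^+ 2)%:E.

Lemma sqsum_ge0 f : (0 <= sqsum f)%E.
Proof. by apply: esum_ge0 => s _; rewrite lee_fin sqr_ge0. Qed.

Lemma sqsum_ge f s : ((rnorm (f s) ^+ 2)%:E <= sqsum f)%E.
Proof.
apply: esum_ge; exists [set s]; first by split; [exact: finite_set1|].
by rewrite fsbig_set1.
Qed.

Lemma sqsum0 : sqsum 0 = 0%E.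
Proof. by apply: esum1 => s _; rewrite rnorm0 expr0n. Qed.

Lemma esumZ_le (a : R) (u : S -> R) : 0 <= a -> (forall s, 0 <= u s) ->
  (\esum_(s in [set: S]) (a * u s)%:E
   <= a%:E * \esum_(s in [set: S]) (u s)%:E)%E.
Proof.
move=> a0 u0; rewrite ge_ereal_sup //= => _ [X XS] <-.
under eq_fsbigr do rewrite EFinM.
rewrite -ge0_mule_fsumr; last by move=> s; rewrite lee_fin.
by rewrite lee_wpmul2l ?lee_fin// esum_ge//; exists X.
Qed.

Lemma sqsumZ a f : sqsum (a *: f) = ((rnorm a ^+ 2)%:E * sqsum f)%E.
Proof.
have le b g : (sqsum (b *: g) <= (rnorm b ^+ 2)%:E * sqsum g)%E.
  apply: le_trans (esumZ_le _ _) => [|//|s]; rewrite ?sqr_ge0//.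
  by apply: le_esum => s _; rewrite lee_fin rnormM exprMn.
have [->|a0] := eqVneq a 0.
  by rewrite scale0r sqsum0 rnorm0 expr0n mul0e.
apply/eqP; rewrite eq_le le/=.
have -> : sqsum f = sqsum (a^-1 *: (a *: f)) by rewrite scalerA mulVf// scale1r.
apply: le_trans (lee_wpmul2l _ (le _ _)) _; first by rewrite lee_fin sqr_ge0.
rewrite muleA -EFinM -exprMn -rnormM mulfV//.
have -> : rnorm (1 : K) = 1 by apply: (can_inj (@of_realK R F));
  rewrite of_rnorm normr1; case: (F).
by rewrite expr1n mul1e.
Qed.

Lemma sqsumD (t : R) f g : 0 < t ->
  (sqsum (f + g)%R <= (1 + t)%R%:E * sqsum f + (1 + t^-1)%R%:E * sqsum g)%E.
Proof.
move=> t0; have ti0 : 0 < t^-1 by rewrite invr_gt0.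
have t1 : 0 <= 1 + t by rewrite addr_ge0// ltW.
have ti1 : 0 <= 1 + t^-1 by rewrite addr_ge0// ltW.
have sq0 (h : S -> K) s : 0 <= rnorm (h s) ^+ 2 by rewrite sqr_ge0.
apply: (le_trans _ (leeD (esumZ_le t1 (sq0 f)) (esumZ_le ti1 (sq0 g)))).
rewrite -esumD.
- apply: le_esum => s _; rewrite -EFinD lee_fin.
  set x := rnorm (f s); set y := rnorm (g s).
  apply: (@le_trans _ _ ((x + y) ^+ 2)).
    by rewrite lerXn2r ?nnegrE ?addr_ge0 ?rnorm_ge0// rnormD.
  rewrite -subr_ge0.
  have -> : (1 + t) * x ^+ 2 + (1 + t^-1) * y ^+ 2 - (x + y) ^+ 2
            = t * (x - t^-1 * y) ^+ 2 by field; rewrite gt_eqF.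
  by rewrite mulr_ge0 ?sqr_ge0// ltW.
- by move=> s _; rewrite lee_fin mulr_ge0.
- by move=> s _; rewrite lee_fin mulr_ge0.
Qed.

Definition square_summable : {pred S -> K} := [pred f | (sqsum f < +oo)%E].

Lemma square_summable_submod_closed : submod_closed square_summable.
Proof.
split=> [|a f g]; rewrite !inE ?sqsum0 ?ltry// => f2 g2.
apply: (le_lt_trans (sqsumD _ _ ltr01)).
by rewrite sqsumZ lte_add_pinfty// ?lte_mul_pinfty ?lee_fin ?sqr_ge0//.
Qed.

HB.instance Definition _ := GRing.isSubmodClosed.Build K (S -> K)
  square_summable square_summable_submod_closed.

End SquareSums.

Section Ell2.
Variables (R : realType) (F : scalar_kind) (S : countType).
Local Notation K := (scalars R F).

Record ell2 : Type := Ell2 {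
  ell2_fun :> S -> K;
  ell2_fun_summable : ell2_fun \in @square_summable R F S }.

HB.instance Definition _ := [isSub for ell2_fun].
HB.instance Definition _ := [Choice of ell2 by <:].
HB.instance Definition _ := [SubChoice_isSubLmodule of ell2 by <:].

Implicit Types f g : ell2.

Definition ell2_norm f : R := Num.sqrt (fine (sqsum f)).

Lemma sqsumE f : sqsum f = (ell2_norm f ^+ 2)%:E.
Proof.
rewrite sqr_sqrtr ?fine_ge0 ?sqsum_ge0// fineK// ge0_fin_numE ?sqsum_ge0//.
exact: (ell2_fun_summable f).
Qed.

Lemma ell2_norm_ge0 f : 0 <= ell2_norm f.
Proof. exact: sqrtr_ge0. Qed.

Lemma ell2_norm_ge f s : rnorm (f s) <= ell2_norm f.
Proof.
have := sqsum_ge f s; rewrite sqsumE lee_fin.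
by rewrite ler_pXn2r ?nnegrE ?rnorm_ge0 ?ell2_norm_ge0.
Qed.

Lemma ell2_norm0_eq0 f : ell2_norm f = 0 -> f = 0.
Proof.
move=> f0; apply/val_inj/funext => s /=; apply: rnorm0_eq0.
by apply/eqP; rewrite eq_le rnorm_ge0 andbT -f0 ell2_norm_ge.
Qed.

Lemma ell2_normZ a f : ell2_norm (a *: f) = rnorm a * ell2_norm f.
Proof.
have := sqsumZ a f; rewrite -[a *: _]/(val (a *: f)) !sqsumE -EFinM -exprMn.
case=> /eqP; rewrite eqrXn2 ?ell2_norm_ge0 ?mulr_ge0 ?rnorm_ge0 ?ell2_norm_ge0//.
by move=> /eqP.
Qed.

Lemma ell2_normD f g : ell2_norm (f + g) <= ell2_norm f + ell2_norm g.
Proof.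
have [f0|f0] := eqVneq (ell2_norm f) 0.
  by rewrite (ell2_norm0_eq0 f0) add0r lerDr ell2_norm_ge0.
have [g0|g0] := eqVneq (ell2_norm g) 0.
  by rewrite (ell2_norm0_eq0 g0) addr0 lerDl ell2_norm_ge0.
have {}f0 : 0 < ell2_norm f by rewrite lt_def f0 ell2_norm_ge0.
have {}g0 : 0 < ell2_norm g by rewrite lt_def g0 ell2_norm_ge0.
rewrite -(@ler_pXn2r _ 2) ?nnegrE ?addr_ge0 ?ell2_norm_ge0//.
have := sqsumD f g (divr_gt0 g0 f0).
rewrite -[(f : S -> K) + _]/(val (f + g)) !sqsumE -!EFinM -EFinD lee_fin.
move=> /le_trans; apply; rewrite le_eqVlt; apply/orP; left; apply/eqP.
by field; rewrite !gt_eqF.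
Qed.

Let norm f : K := of_real F (ell2_norm f).

Let ler_normD f g : norm (f + g) <= norm f + norm g.
Proof. by rewrite -of_realD of_real_le ell2_normD. Qed.

Let normrZ a f : norm (a *: f) = `|a| * norm f.
Proof. by rewrite -of_rnorm -of_realM -ell2_normZ. Qed.

Let normr0_eq0 f : norm f = 0 -> f = 0.
Proof.
by rewrite -(of_real0 R F) => /(can_inj (@of_realK R F)) /ell2_norm0_eq0.
Qed.

HB.instance Definition _ :=
  Lmodule_isNormed.Build K ell2 ler_normD normrZ normr0_eq0.

Lemma rnorm_ell2 f : rnorm f = ell2_norm f.
Proof. exact: of_realK. Qed.

End Ell2.

Section ReproducingKernelSubspace.
Variables (R : realType) (F : scalar_kind) (S : countType).

Definition reproducing_kernel_subspace (W : set (ell2 R F S)) : Prop :=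
  [/\ submod_closed [in W], closed W &
      forall s : S, {within W, continuous (fun f : ell2 R F S => f s)}].

End ReproducingKernelSubspace.

Section Frames.
Variables (R : realType) (F : scalar_kind) (S : countType).
Local Notation K := (scalars R F).
Variables (H : normedModType K) (dot : {dot H for @scalar_conj R F}).

Definition induces_norm : Prop := forall f : H, dot f f = `|f| ^+ 2.

(* [dot] is linear in its first variable and conjugate-linear in the second
   one; [inner] has the opposite convention. *)
Definition inner (u f : H) : K := dot f u.

Lemma innerDr u f g : inner u (f + g) = inner u f + inner u g.
Proof. exact: linearDl. Qed.

Lemma innerZr a u f : inner u (a *: f) = a * inner u f.
Proof. exact: linearZl_LR. Qed.

Lemma innerDl u w f : inner (u + w) f = inner u f + inner w f.
Proof. exact: linearDr. Qed.

Lemma innerZl a u f : inner (a *: u) f = scalar_conj a * inner u f.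
Proof. exact: linearZr_LR. Qed.

Variable v : S -> H.

(* The identity takes place in the extended reals; it includes the convergence
   of the series. *)
Definition tight_frame (c : R) : Prop :=
  0 < c /\
  forall f : H, (rnorm f ^+ 2)%:E = (c%:E * sqsum (fun s => inner (v s) f))%E.

Definition gram (s t : S) : K := inner (v s) (v t).

End Frames.

(* Main.v *)
Require Import Defs.
From HB Require Import structures.
From mathcomp Require Import all_boot all_order all_algebra.
From mathcomp Require Import sesquilinear complex.
From mathcomp Require Import all_classical all_reals.
From mathcomp Require Import ereal esum topology normedtype.
Set Implicit Arguments.
Unset Strict Implicit.
Unset Printing Implicit Defensive.
Import Order.TTheory GRing.Theory Num.Theory.
Import numFieldNormedType.Exports.
Local Open Scope classical_set_scope.
Local Open Scope ring_scope.

(** The tight frame identity says exactly that the analysis map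
    [J f = (s |-> <v(s) | f>)] satisfies [|f| = sqrt c * |J f|].  Everything
    follows from this.  Finiteness of the right-hand side of the identity puts
    [J f] in l2 ([frame_coef_summable]); the map is injective because it
    multiplies norms by a nonzero constant; and since it is both bounded and
    bounded below on a complete space, its range is closed
    ([closed_range_bounded_below]).

    Evaluations are continuous on all of l2, hence on the range, because
    [|f s|] is at most the l2 norm of [f].  The sharper pointwise bound is the
    Cauchy-Schwarz inequality [norm_inner_le] for [<v(s) | f>], together with
    [k(s, s) = |v(s)|^2].

    The real and complex scalars are treated at once: the argument sees
    conjugation only as a map that respects products, opposites and inverses,
    fixes norms, and satisfies [x * conj x = |x|^2]. *)

(** Pull the neighbourhoods of a point [g] adherent to the range back along
    [J].  The resulting filter is proper because [g] is adherent, and the lower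
    bound on [J] makes it Cauchy, so it has a limit by completeness; continuity
    of [J] sends this limit to [g]. *)
Lemma closed_range_bounded_below (K : numFieldType)
    (V : completeNormedModType K) (W : normedModType K)
    (J : {linear V -> W}) (a : K) :
  0 < a -> (forall x, `|x| <= a * `|J x|) -> continuous J -> closed (range J).
Proof.
move=> a0 Ja Jc; apply/closure_id/seteqP; split; first exact: subset_closure.
move=> g gJ; pose G := filter_from (nbhs g) (fun B => J @^-1` B).
have JG : J @ G --> g by move=> B gB; exists B.
have GF : ProperFilter G.
  apply: filter_from_proper => [|B /gJ[_ [[x _ <-] Bx]]]; last by exists x.
  apply: filter_from_filter; first by exists setT; exact: filterT.
  by move=> A B gA gB; exists (A `&` B) => //; exact: filterI.
have /cauchy_cvgP Gcvg : cauchy G.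
  apply: cauchy_exP => e e0.
  have gB : nbhs g (ball g (e / a / 2)).
    by apply: nbhsx_ballx; rewrite !divr_gt0.
  have [_ [[x _ <-] gx]] := gJ _ gB.
  (* Two preimages of the ball of radius e / (2 a) are at distance less than
     e from each other. *)
  exists x, (ball g (e / a / 2)) => // y gy.
  rewrite -ball_normE /=; apply: le_lt_trans (Ja _) _.
  rewrite mulrC -ltr_pdivlMr// linearB.
  suff : ball (J x) (e / a) (J y) by rewrite -ball_normE.
  by rewrite [e / a]splitr; apply: ball_triangle gy; exact: ball_sym.
exists (lim G) => //.
apply: (@cvg_unique _ (@norm_hausdorff K W) (J @ G)) => //.
exact: continuous_cvg (Jc _) Gcvg.
Qed.

Lemma bounded_above_continuous (K : numFieldType) (V W : normedModType K)
    (f : {linear V -> W}) (a : K) :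
  0 < a -> (forall x, `|f x| <= a * `|x|) -> continuous f.
Proof.
move=> a0 fa x; apply/cvgrPdist_lt => e e0; near=> y.
rewrite -linearB; apply: le_lt_trans (fa _) _.
rewrite mulrC -ltr_pdivlMr//.
by near: y; apply: cvgr_dist_lt; rewrite ?divr_gt0.
Unshelve. all: by end_near. Qed.

Section Scalars.
Variables (R : realType) (F : scalar_kind).
Local Notation K := (scalars R F).

Lemma mul_scalar_conj (x : K) : x * scalar_conj x = `|x| ^+ 2.
Proof.
by move: x; case: F => /= x; [rewrite real_normK ?num_real|rewrite -normCK].
Qed.

Lemma scalar_conj_norm (V : normedZmodType K) (x : V) :
  scalar_conj `|x| = `|x|.
Proof.
by rewrite -of_rnorm; move: (rnorm x); case: F => //= r; rewrite oppr0.
Qed.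

Lemma scalar_conjM (x y : K) :
  scalar_conj (x * y) = scalar_conj x * scalar_conj y.
Proof. by move: x y; case: F => //= x y; rewrite -rmorphM. Qed.

Lemma scalar_conjN (x : K) : scalar_conj (- x) = - scalar_conj x.
Proof. by move: x; case: F => //= x; rewrite -rmorphN. Qed.

Lemma scalar_conjV (x : K) : scalar_conj x^-1 = (scalar_conj x)^-1.
Proof. by move: x; case: F => //= x; rewrite -fmorphV. Qed.

Lemma of_real_gt0 (a : R) : (0 < of_real F a) = (0 < a).
Proof.
by rewrite !lt_neqAle -(of_real0 R F) of_real_le (can_eq (@of_realK R F)).
Qed.

End Scalars.

Section CauchySchwarz.
Variables (R : realType) (F : scalar_kind).
Local Notation K := (scalars R F).
Variables (H : normedModType K) (dot : {dot H for @scalar_conj R F}).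
Hypothesis dot_norm : induces_norm dot.

Lemma inner_conj (u f : H) : inner dot f u = scalar_conj (inner dot u f).
Proof.
have := @hermitian_subproof _ _ _ _ dot u f.
by rewrite expr0 mul1r.
Qed.

(** Cauchy-Schwarz, proved directly so that it covers real and complex scalars
    alike: the component of [f] orthogonal to [u] has squared norm
    [|f|^2 - |<u | f>|^2 / |u|^2], which is nonnegative. *)
Lemma norm_inner_le (u f : H) : `|inner dot u f| <= `|u| * `|f|.
Proof.
have [->|u0] := eqVneq u 0.
  by rewrite normr0 mul0r /inner linear0r normr0.
have nu0 : 0 < `|u| by rewrite normr_gt0.
set a := inner dot u f.
(* w is the component of f orthogonal to u *)
pose b := - (a / `|u| ^+ 2); pose w := f + b *: u.
have a2 : a * scalar_conj a = `|a| ^+ 2 := mul_scalar_conj a.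
have wE : `|w| ^+ 2 = `|f| ^+ 2 - `|a| ^+ 2 / `|u| ^+ 2.
  have bE : scalar_conj b = - (scalar_conj a / `|u| ^+ 2).
    by rewrite scalar_conjN scalar_conjM scalar_conjV expr2 scalar_conjM
      scalar_conj_norm.
  rewrite -dot_norm -[dot w w]/(inner dot w w).
  rewrite innerDr innerZr !innerDl !innerZl.
  rewrite -/a (inner_conj u f) -/a bE.
  rewrite -[inner dot f f]/(dot f f) -[inner dot u u]/(dot u u) !dot_norm.
  rewrite -[in X in _ + X]mulNr divfK ?gt_eqF ?exprn_gt0//.
  by rewrite subrr mulr0 addr0 mulNr mulrAC [scalar_conj a * a]mulrC a2.
have : 0 <= `|w| ^+ 2 by rewrite exprn_ge0.
rewrite wE subr_ge0 ler_pdivrMr ?exprn_gt0// -exprMn mulrC.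
by rewrite ler_pXn2r ?nnegrE ?mulr_ge0.
Qed.

End CauchySchwarz.

Section FrameAnalysis.
Variables (R : realType) (F : scalar_kind) (S : countType).
Local Notation K := (scalars R F).
Variables (H : normedModType K) (dot : {dot H for @scalar_conj R F}).
Variables (v : S -> H) (c : R).
Hypothesis v_frame : tight_frame dot v c.

(** If the square sum were infinite, so would be [|f|^2], as [c > 0]. *)
Lemma frame_coef_summable (f : H) :
  (fun s => inner dot (v s) f) \in @square_summable R F S.
Proof.
have [c0 /(_ f) fE] := v_frame; rewrite inE ltNge; apply/negP => oo.
move: fE; have -> : sqsum (fun s => inner dot (v s) f) = +oo%E.
  by apply/eqP; rewrite -leye_eq.
by rewrite gt0_muley ?lte_fin.
Qed.

Definition frame_analysis (f : H) : ell2 R F S := Ell2 (frame_coef_summable f).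

Lemma frame_analysis_linear : linear frame_analysis.
Proof.
by move=> a f g; apply/val_inj/funext => s /=; rewrite innerDr innerZr.
Qed.

HB.instance Definition _ :=
  GRing.isLinear.Build K H (ell2 R F S) _ frame_analysis frame_analysis_linear.

Lemma rnorm_frame_analysis (f : H) :
  rnorm f = Num.sqrt c * rnorm (frame_analysis f).
Proof.
have [c0 /(_ f)] := v_frame.
rewrite -[X in sqsum X]/(ell2_fun (frame_analysis f)) sqsumE -EFinM => -[].
rewrite -{1}(sqr_sqrtr (ltW c0)) -exprMn rnorm_ell2 => /eqP.
by rewrite eqrXn2 ?mulr_ge0 ?sqrtr_ge0 ?ell2_norm_ge0 ?rnorm_ge0// => /eqP.
Qed.

Lemma norm_frame_analysis (f : H) :
  `|f| = of_real F (Num.sqrt c) * `|frame_analysis f|.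
Proof. by rewrite -!of_rnorm -of_realM -rnorm_frame_analysis. Qed.

Lemma frame_analysis_inj : injective frame_analysis.
Proof.
move=> f g /eqP; rewrite -subr_eq0 -linearB => /eqP Jfg.
apply/eqP; rewrite -subr_eq0; apply/eqP/rnorm0_eq0.
by rewrite rnorm_frame_analysis Jfg rnorm0 mulr0.
Qed.

Let sqrtc_gt0 : 0 < of_real F (Num.sqrt c).
Proof. by have [c0 _] := v_frame; rewrite of_real_gt0 sqrtr_gt0. Qed.

Lemma frame_analysis_continuous : continuous frame_analysis.
Proof.
apply: (@bounded_above_continuous _ _ _ _ (of_real F (Num.sqrt c))^-1) => [|f].
  by rewrite invr_gt0.
by rewrite norm_frame_analysis mulKf ?gt_eqF.
Qed.

End FrameAnalysis.

(** Evaluation is 1-Lipschitz for the l2 norm. *)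
Lemma ell2_eval_continuous (R : realType) (F : scalar_kind) (S : countType)
  (s : S) : continuous (fun f : ell2 R F S => f s).
Proof.
move=> f.
apply/(@cvgrPdist_lt _ _ _ (nbhs f)) => e e0; near=> g.
rewrite -[f s - g s]/((f - g) s); apply: (@le_lt_trans _ _ `|f - g|).
  by rewrite -!of_rnorm of_real_le rnorm_ell2 ell2_norm_ge.
by near: g; apply: cvgr_dist_lt.
Unshelve. all: by end_near. Qed.

Theorem theorem5p5 (R : realType) (F : scalar_kind) (S : countType)
    (H : completeNormedModType (scalars R F))
    (dot : {dot H for @scalar_conj R F}) (dot_norm : induces_norm dot)
    (v : S -> H) (c : R) (v_frame : tight_frame dot v c) :
  exists J : {linear H -> ell2 R F S},
    [/\ forall (f : H) (s : S), J f s = inner dot (v s) f,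
        injective J,
        forall f : H, rnorm f = Num.sqrt c * rnorm (J f),
        reproducing_kernel_subspace (range J) &
        forall (s : S) (f : H),
          rnorm (J f s) <= Num.sqrt (real_part (gram dot v s s)) * rnorm f].
Proof.
have [c0 _] := v_frame.
pose J : {linear H -> ell2 R F S} := frame_analysis v_frame.
exists J; split=> //.
- exact: frame_analysis_inj.
- exact: rnorm_frame_analysis.
- split=> [||s].
  + split=> [|a _ _ /set_mem[f _ <-] /set_mem[g _ <-]]; apply/mem_set.
      by exists 0 => //; rewrite linear0.
    by exists (a *: f + g) => //; rewrite linearP.
  + apply: (@closed_range_bounded_below _ _ _ J (of_real F (Num.sqrt c))).
    * by rewrite of_real_gt0 sqrtr_gt0.
    * by move=> f; rewrite -norm_frame_analysis.
    * exact: frame_analysis_continuous.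
  + exact/continuous_subspaceT/ell2_eval_continuous.
- move=> s f.
  (* The diagonal of the Gram matrix consists of the squared norms of the frame
     vectors. *)
  have -> : real_part (gram dot v s s) = rnorm (v s) ^+ 2.
    rewrite /gram /inner dot_norm -of_rnorm expr2 -of_realM of_realK.
    by rewrite expr2.
  rewrite sqrtr_sqr ger0_norm ?rnorm_ge0// -(of_real_le F) of_realM !of_rnorm.
  exact: norm_inner_le.
Qed.
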